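(* Let $Y$ be a Boolean degree $1$ function on $J_q(n, k)$ of size $x \genfrac{[}{]}{0pt}{}{n-1}{k-1}_q$. If $Y$ is neither the empty set nor the set of all $k$-subspaces through a fixed point (1-subspace) of $V$, then \[ x \geq \frac{[n-1]}{q[k-1]^2[k]} > \frac{1}{8} q^{n - 3k + 2}. \]
   Context: $q$ is a prime power and $V$ is an $n$-dimensional vector space over the field with $q$ elements. $J_q(n,k)$ is the set of $k$-dimensional subspaces of $V$. A Boolean degree $1$ function on $J_q(n,k)$ is a function $f$ from the $k$-subspaces of $V$ to $\{0,1\}$ given by a real weighting $\mathrm{wt}$ of the points (1-subspaces) of $V$ such that $f(S)=\sum_{P \subseteq S} \mathrm{wt}(P) \in \{0,1\}$ for every $k$-subspace $S$; it is identified with the family $Y$ of $k$-subspaces $S$ with $f(S)=1$, and its size is $|Y|$. Here $[a] := \frac{q^a-1}{q-1}$ and $\genfrac{[}{]}{0pt}{}{a}{b}_q := \prod_{i=1}^b \frac{[a-i+1]}{[i]}$ is the $q$-binomial coefficient, the number of $b$-subspaces of an $a$-dimensional space.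
   Formalization: Assumes k ≥ 2 (for k = 1 the bound divides by [0] = 0) and, when k = 2, that Y is not the set of all 2-subspaces of a hyperplane of V; for those Y with n ≥ 3, x = [n-2]/[2] < [n-1]/(q[2]), so the claim as printed fails. *)

(* Defs.v *)
From HB Require Import structures.
From mathcomp Require Import all_boot all_order all_algebra.
From mathcomp Require Import reals.

Set Implicit Arguments.
Unset Strict Implicit.
Unset Printing Implicit Defensive.

Import Order.TTheory GRing.Theory Num.Theory.
Local Open Scope ring_scope.

(* The subtype structure of {vspace V} over canonical matrices is only visible
   under VectorInternalTheory. *)
Section VspaceFinite.
Import VectorInternalTheory.

HB.instance Definition _ (F : finFieldType) (V : vectType F) :=
  [Countable of @space F V by <:].
HB.instance Definition _ (F : finFieldType) (V : vectType F) :=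
  [Finite of @space F V by <:].

End VspaceFinite.

Definition qint (R : realType) (q a : nat) : R :=
  (q%:R ^+ a - 1) / (q%:R - 1).

(* a.+1 - i is a - i + 1 written so that truncated subtraction gives
   [0] = 0 at i = a + 1, as it should when b > a. *)
Definition qbinom (R : realType) (q a b : nat) : R :=
  \prod_(1 <= i < b.+1) (qint R q (a.+1 - i) / qint R q i).

Section Grassmannian.
Variables (F : finFieldType) (V : vectType F).
Implicit Types (S P H : {vspace V}) (Y : {set {vspace V}}).

Definition subspaces (k : nat) : {set {vspace V}} := [set S | \dim S == k].

(* Only the values of wt on 1-subspaces matter. *)
Definition degree1_fun (R : realType) (wt : {vspace V} -> R) S : R :=
  \sum_(P in subspaces 1 | (P <= S)%VS) wt P.

Definition boolean_degree1 (R : realType) (k : nat) Y : Prop :=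
  exists wt : {vspace V} -> R,
    (forall S, S \in subspaces k ->
       degree1_fun wt S = 0 \/ degree1_fun wt S = 1) /\
    Y = [set S in subspaces k | degree1_fun wt S == 1].

Definition pencil (k : nat) P : {set {vspace V}} :=
  [set S in subspaces k | (P <= S)%VS].

(* For k = 2 and \dim H = n - 1 with n >= 3, this is a Boolean degree 1 function
   with x = [n-2]/[2] < [n-1]/(q [2]). *)
Definition subspaces_in (k : nat) H : {set {vspace V}} :=
  [set S in subspaces k | (S <= H)%VS].

End Grassmannian.

(* Main.v *)
(** Write [wt W] for the total weight of the points in a subspace [W]; then
    [x] is the weight of the whole space. Summing the function over the
    [k]-subspaces containing a given [(k-1)]-subspace [U] gives
    [wt V + q[n-k] wt U >= 0]. If some member [S] of [Y] has a point [P] with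
    [wt P >= 1/[k]], and [P] lies on a [k]-subspace [T] outside [Y], then
    averaging over the hyperplanes of [T] that avoid [P] yields a [U] with
    [wt U <= - wt P / q], hence [x >= [n-k]/[k]]. If instead [Y] contains the
    pencil of [P], removing that pencil lowers [x] by one and leaves a nonempty
    family to which the previous argument applies. The resulting bounds suffice,
    except when [k = 2] and [Y] contains no pencil: there, a violation of the
    claim forces every point to lie on [0] or [[n-2]] lines of [Y], so that the
    points on some line of [Y] form a hyperplane. *)

Require Import Defs.
From HB Require Import structures.
From mathcomp Require Import all_boot all_order all_algebra.
From mathcomp Require Import reals.
From mathcomp Require Import finfield ring lra zify.

Set Implicit Arguments.
Unset Strict Implicit.
Unset Printing Implicit Defensive.

Import Order.TTheory GRing.Theory Num.Theory.
Local Open Scope ring_scope.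

(** * q-integers and q-binomial coefficients *)

Section QInt.
Variables (R : realType) (q : nat).
Hypothesis q_gt1 : (1 < q)%N.

Lemma subq1_gt0 : 0 < q%:R - 1 :> R.
Proof. by rewrite subr_gt0 ltr1n. Qed.

Lemma qintM1 a : qint R q a * (q%:R - 1) = q%:R ^+ a - 1.
Proof. by rewrite /qint divfK // gt_eqF // subq1_gt0. Qed.

Lemma qint0 : qint R q 0 = 0.
Proof. by rewrite /qint expr0 subrr mul0r. Qed.

Lemma qintD a b : qint R q (a + b) = qint R q a + q%:R ^+ a * qint R q b.
Proof.
apply: (mulIf (lt0r_neq0 subq1_gt0)).
rewrite mulrDl qintM1 -(mulrA (q%:R ^+ a)) (qintM1 b) qintM1 exprD; ring.
Qed.

Lemma qint1 : qint R q 1 = 1.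
Proof. by rewrite /qint expr1 divff // gt_eqF // subq1_gt0. Qed.

Lemma qint_gt0 a : (0 < a)%N -> 0 < qint R q a.
Proof.
move=> a0; rewrite /qint divr_gt0 ?subq1_gt0 // subr_gt0.
by rewrite exprn_egt1 ?ltr1n // -lt0n.
Qed.

Lemma qint_ge0 a : 0 <= qint R q a.
Proof. by case: a => [|a]; rewrite ?qint0 // ltW // qint_gt0. Qed.

Lemma qint_nat a : exists m : nat, qint R q a = m%:R.
Proof.
elim: a => [|a [m IHm]]; first by exists 0%N; rewrite qint0.
by exists (1 + q * m)%N; rewrite -add1n qintD qint1 IHm expr1 natrD natrM.
Qed.

(** The first numerator factor and the last denominator factor split off from the product. This
    recursion matches the double count in [card_subspaces_over]. *)
Lemma qbinomS a b : (0 < b)%N ->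
  qbinom R q a.+1 b * qint R q b = qint R q a.+1 * qbinom R q a b.-1.
Proof.
have qbE c d : qbinom R q c d = (\prod_(1 <= i < d.+1) qint R q (c.+1 - i)) /
  \prod_(1 <= i < d.+1) qint R q i by exact: prodf_div.
case: b => // b _; rewrite !qbE big_ltn // subSS subn0 big_add1.
rewrite [X in _ * X^-1 * _]big_nat_recr //= invfM -!mulrA mulVf ?mulr1 //.
by rewrite gt_eqF // qint_gt0.
Qed.

Lemma qbinom0 a : qbinom R q a 0 = 1.
Proof. by rewrite /qbinom big_geq. Qed.

Lemma qbinom_gt0 a b : (b <= a)%N -> 0 < qbinom R q a b.
Proof.
move=> ba; rewrite /qbinom big_nat; apply: prodr_gt0 => i /andP[i1 ib].
by rewrite divr_gt0 // qint_gt0 // subn_gt0; lia.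
Qed.

End QInt.

(** * Counting vectors and points *)

Lemma card_vspaceT (F : finFieldType) (V : vectType F) (W : {vspace V}) :
  #|[pred v : finvect_type V | (v : V) \in W]| = (#|F| ^ \dim W)%N.
Proof.
case: V W => T c W.
by rewrite -(@card_vspace F (finvect_type (Vector.Pack c)) c W); apply: eq_card.
Qed.

Section Points.
Variables (F : finFieldType) (V : vectType F).
Implicit Types (W P S H : {vspace V}).

Lemma dim1_eqP P v : \dim P = 1%N -> v != 0 -> (<[v]>%VS == P) = (v \in P).
Proof. by move=> P1 v0; rewrite eqEdim -memvE dim_vline v0 P1 andbT. Qed.

Lemma dim1_subv P Q : \dim P = 1%N -> \dim Q = 1%N -> (P <= Q)%VS = (P == Q).
Proof. by move=> P1 Q1; rewrite eqEdim P1 Q1 andbT. Qed.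

Lemma subv_points S H :
  (forall P, \dim P = 1%N -> (P <= S)%VS -> (P <= H)%VS) -> (S <= H)%VS.
Proof.
move=> pts; apply/subvP => v vS; case: (eqVneq v 0) => [->|v0]; first exact: mem0v.
by rewrite memvE; apply: pts; rewrite ?dim_vline ?v0 // -memvE.
Qed.

Lemma card_nz_vspace W :
  #|[pred v : finvect_type V | ((v : V) \in W) && (v != 0)]| = (#|F| ^ \dim W).-1.
Proof.
rewrite -card_vspaceT [in RHS](cardD1 0) !inE mem0v add1n /=.
by apply: eq_card => v; rewrite !inE andbC.
Qed.

(** The map sending a nonzero vector to its span has fibres of size [q - 1], the nonzero vectors of
    a point. *)
Lemma card_points W :
  (#|[set P in subspaces V 1 | (P <= W)%VS]| * #|F|.-1 = (#|F| ^ \dim W).-1)%N.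
Proof.
rewrite -card_nz_vspace -[in RHS]sum1_card.
rewrite (partition_big (fun v : finvect_type V => <[v : V]>%VS)
   [in [set P in subspaces V 1 | (P <= W)%VS]]) /=; last first.
  by move=> v /andP[vW v0]; rewrite !inE dim_vline v0 /= -memvE.
rewrite -sum_nat_const; apply: eq_bigr => P.
rewrite !inE => /andP[/eqP P1 PW].
rewrite sum1_card -[X in X.-1]expn1 -P1 -card_nz_vspace.
apply: eq_card => v.
rewrite [LHS](_ : _ = ((v : V) \in P) && (v != 0)) //.
rewrite [RHS](_ : _ = ((v : V) \in W) && (v != 0) && (<[v : V]>%VS == P)) //.
case: (eqVneq v 0) => [->|v0]; first by rewrite !andbF.
rewrite !andbT dim1_eqP //; case vP : ((v : V) \in P); last by rewrite andbF.
by rewrite (subvP PW).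
Qed.

Lemma card_finField_gt1 : (1 < #|F|)%N.
Proof. exact: finNzRing_gt1. Qed.

(** Expresses point counts as a degree 1 function, so that identities for arbitrary weights also
    count subspaces. *)
Lemma degree1_const (R : realType) W :
  degree1_fun (fun=> 1 : R) W = qint R #|F| (\dim W).
Proof.
have q1 : (1 < #|F|)%N := card_finField_gt1.
apply: (mulIf (lt0r_neq0 (subq1_gt0 R q1))).
rewrite qintM1 // /degree1_fun sumr_const.
have cW := card_points W.
have qW : (0 < #|F| ^ \dim W)%N by rewrite expn_gt0 ltnW.
rewrite -natrX -(prednK qW) -cW -[in _ - 1](prednK (ltnW q1)) -!natr1 !addrK.
by rewrite natrM; congr (_%:R * _); apply: eq_card => P; rewrite [RHS]inE.
Qed.

End Points.

Lemma exists_le_mean (R : realType) (T : finType) (A : {set T}) (f : T -> R) c :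
  (0 < #|A|)%N -> \sum_(i in A) f i <= c * #|A|%:R -> exists2 i, i \in A & f i <= c.
Proof.
rewrite card_gt0 => /set0Pn[i0 Ai0] lef; apply/exists_inP.
apply: contraT => /exists_inPn H; move: lef; rewrite mulr_natr -sumr_const leNgt.
case/negP; apply: ltr_sum => [|i /H]; last by rewrite -ltNge.
by apply/hasP; exists i0; rewrite ?mem_index_enum.
Qed.

(** * Subspaces between two given ones *)

Section Covers.
Variables (F : finFieldType) (V : vectType F).
Implicit Types (K U W P S H L Z : {vspace V}).

Lemma dim_addv_point K P :
  \dim P = 1%N -> ~~ (P <= K)%VS -> \dim (K + P) = (\dim K).+1.
Proof.
move=> P1 PK; rewrite dimv_disjoint_sum ?P1 ?addn1 //.
apply/eqP; rewrite -dimv_eq0 -leqn0 -ltnS -[X in (_ < X)%N]P1.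
rewrite ltn_neqAle dimvS ?capvSr // andbT.
apply: contra PK => /eqP eqd; have /eqP : (K :&: P)%VS == P.
  by rewrite eqEdim capvSr eqd /=.
by move=> <-; apply: capvSl.
Qed.

Lemma exists_between K W e : (K <= W)%VS -> (\dim K <= e <= \dim W)%N ->
  exists U, [/\ (K <= U)%VS, (U <= W)%VS & \dim U = e].
Proof.
move=> KW /andP[Ke eW]; elim: e Ke eW => [|e IHe] Ke eW.
  by exists K; split=> //; apply/eqP; rewrite -leqn0.
move: Ke; rewrite leq_eqVlt => /predU1P[Ke|Ke]; first by exists K.
have [U [KU UW Ue]] := IHe Ke (ltnW eW).
have /subvPn[v vW vU] : ~~ (W <= U)%VS.
  by apply/negP => /dimvS; rewrite Ue leqNgt eW.
exists (U + <[v]>)%VS; split.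
- exact: subv_trans (addvSl _ _).
- by rewrite subv_add UW -memvE.
- rewrite dim_addv_point ?Ue -?memvE // dim_vline.
  by case: eqP vU => // ->; rewrite mem0v.
Qed.

Lemma exists_point S : (0 < \dim S)%N -> exists2 P, \dim P = 1%N & (P <= S)%VS.
Proof.
by move=> S0; have [|P [_ PS P1]] := @exists_between 0%VS S 1 (sub0v _);
  [rewrite dimv0 | exists P].
Qed.

(** Closure under lines makes a maximal subspace [H] inside [A] contain all of [A]. It is proper
    because some point fails [A], and its complement contains no line because every line meets [A];
    hence it is a hyperplane. *)
Lemma hyperplane_of_points (A : pred {vspace V}) :
    (forall L P Q Z, \dim L = 2%N -> \dim P = 1%N -> \dim Q = 1%N ->
      \dim Z = 1%N -> (P <= L)%VS -> (Q <= L)%VS -> (Z <= L)%VS ->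
      P != Q -> A P -> A Q -> A Z) ->
    (forall L, \dim L = 2%N -> exists P, [/\ \dim P = 1%N, (P <= L)%VS & A P]) ->
    (exists2 Z, \dim Z = 1%N & ~~ A Z) ->
  exists2 H, \dim H = (\dim {:V}).-1 & forall P, \dim P = 1%N -> A P = (P <= H)%VS.
Proof.
move=> lineA meetA [Z0 Z01 AZ0].
pose good W := [forall P in subspaces V 1, (P <= W)%VS ==> A P].
have goodP W : reflect (forall P, \dim P = 1%N -> (P <= W)%VS -> A P) (good W).
  apply: (iffP forall_inP) => gW P; last first.
    by rewrite inE => /eqP P1; apply/implyP; apply: gW.
  by move=> P1; apply/implyP/gW; rewrite inE P1.
have good0 : good 0%VS.
  by apply/goodP => P P1; rewrite subv0 -dimv_eq0 P1.
case: (arg_maxnP (fun W : {vspace V} => \dim W) good0) => H /goodP gH maxH.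
have AH P : \dim P = 1%N -> A P = (P <= H)%VS.
  move=> P1; apply/idP/idP => [AP|]; last exact: gH.
  apply: contraT => PH; have dHP := dim_addv_point P1 PH.
  suff /maxH : good (H + P)%VS by rewrite /= dHP ltnn.
  apply/goodP => Z Z1 ZHP; case: (eqVneq Z P) => [->//|ZP].
  (* Inside [H + P], where [H] has codimension 1, the line [P + Z] meets [H] in a point [X]. Then
     [X] and [P] are distinct points of [A] on a line through [Z]. *)
  have dL : \dim (P + Z) = 2%N by rewrite dim_addv_point ?P1 // dim1_subv.
  have [|X X1] := @exists_point ((P + Z) :&: H).
    have := dimv_sum_cap (P + Z) H; rewrite dL.
    have : (\dim (P + Z + H) <= (\dim H).+1)%N.
      by rewrite -dHP dimvS // !subv_add addvSr ZHP addvSl.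
    lia.
  rewrite subv_cap => /andP[XL XH].
  apply: (lineA _ X P Z dL X1 P1 Z1 XL) => //; rewrite ?addvSl ?addvSr //.
    by apply: contra PH => /eqP <-.
  exact: gH.
exists H => //; apply/eqP; rewrite eqn_leq; apply/andP; split.
  rewrite -ltnS prednK; last by rewrite -Z01 dimvS ?subvf.
  rewrite ltn_neqAle dimvS ?subvf // andbT; apply: contra AZ0 => /eqP dH.
  rewrite AH // (_ : H = fullv) ?subvf //; apply/eqP.
  by rewrite eqEdim subvf dH leqnn.
rewrite leqNgt; apply/negP => dH.
have [|L [_ LH dL]] := @exists_between 0%VS H^C 2 (sub0v _).
  by rewrite dimv0 dimv_compl; lia.
have [P [P1 PL]] := meetA _ dL; rewrite AH // => PH.
have : (P <= H :&: H^C)%VS by rewrite subv_cap PH (subv_trans PL LH).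
by rewrite capv_compl subv0 -dimv_eq0 P1.
Qed.

(** These correspond to the points of the quotient of [W] by [K]. *)
Definition covers K W : {set {vspace V}} :=
  [set U in subspaces V (\dim K).+1 | (K <= U)%VS && (U <= W)%VS].

Section Weights.
Variables (R : realType) (wt : {vspace V} -> R).
Local Notation D := (degree1_fun wt).
Local Notation q := #|F|.

Lemma degree1_point P : \dim P = 1%N -> D P = wt P.
Proof.
move=> P1; rewrite /degree1_fun (big_pred1 P) // => Q /=.
rewrite inE; case: (\dim Q =P 1%N) => [Q1|/eqP Q1] /=; first exact: dim1_subv.
by apply/esym/eqP => QP; rewrite QP P1 in Q1.
Qed.

Lemma degree1_0 : D 0 = 0.
Proof.
rewrite /degree1_fun big1 // => P; rewrite inE subv0 -dimv_eq0.
by case/andP => /eqP->.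
Qed.

Lemma degree1B K U : (K <= U)%VS ->
  D U - D K = \sum_(P in subspaces V 1 | (P <= U)%VS && ~~ (P <= K)%VS) wt P.
Proof.
move=> KU; rewrite /degree1_fun (bigID (fun P => (P <= K)%VS)) /=.
rewrite [X in X + _ - _](_ : _ = \sum_(P in subspaces V 1 | (P <= K)%VS) wt P).
  rewrite addrC addKr; apply: eq_bigl => P; by rewrite andbA.
apply: eq_bigl => P; rewrite -andbA; case PK: (P <= K)%VS; last by rewrite !andbF.
by rewrite (subv_trans PK KU).
Qed.

(** Each point [P] of [W] outside [K] lies in exactly one cover, namely [K + P]. *)
Lemma sum_covers K W : (K <= W)%VS ->
  \sum_(U in covers K W) (D U - D K) = D W - D K.
Proof.
move=> KW; rewrite degree1B //.
rewrite [RHS](partition_big (fun P => (K + P)%VS) [in covers K W]) /=.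
  apply: eq_bigr => U; rewrite !inE => /and3P[/eqP dU KU UW].
  rewrite degree1B //; apply: eq_bigl => P; rewrite !inE -!andbA.
  case P1: (\dim P == 1%N) => //=; case PK: (P <= K)%VS; rewrite /= ?andbF //.
  rewrite eqEdim subv_add KU dU dim_addv_point ?PK ?(eqP P1) // leqnn !andbT /=.
  by case PU: (P <= U)%VS; rewrite ?andbF // (subv_trans PU UW).
move=> P; rewrite !inE => /and3P[/eqP P1 PW PK].
by rewrite dim_addv_point // eqxx addvSl subv_add KW PW.
Qed.

End Weights.

Variable (R : realType).
Local Notation q := #|F|.
Local Notation qi := (qint R q).

(** With constant weight 1, every summand of [sum_covers] equals [q ^ dim K]. *)
Lemma card_covers K W : (K <= W)%VS ->
  #|covers K W|%:R = qi (\dim W - \dim K).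
Proof.
move=> KW; have := sum_covers (fun=> 1 : R) KW.
have q1 : (1 < q)%N := card_finField_gt1 F.
have q0 : q%:R ^+ \dim K != 0 :> R.
  by rewrite expf_neq0 // pnatr_eq0 -lt0n ltnW.
rewrite (eq_bigr (fun=> q%:R ^+ \dim K)) => [|U].
  rewrite sumr_const !degree1_const -{1}(subnKC (dimvS KW)) qintD // addrC addKr.
  by rewrite -[LHS]mulr_natr => /(mulfI q0).
rewrite !inE => /and3P[/eqP dU KU UW].
by rewrite !degree1_const dU -addn1 qintD // qint1 // mulr1 addrC addKr.
Qed.

(** Induction on [k - dim K], counting in two ways the pairs of a cover [U] of [K] and a
    [k]-subspace [S] containing [U]. *)
Lemma card_subspaces_over k K :
  (\dim K <= k)%N -> (k <= \dim {:V})%N ->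
  #|[set S in subspaces V k | (K <= S)%VS]|%:R =
    qbinom R q (\dim {:V} - \dim K) (k - \dim K).
Proof.
have q1 : (1 < q)%N := card_finField_gt1 F.
move=> + kn; have [e] := ubnP (k - \dim K); elim: e K => // e IHe K eK Kk.
move: Kk; rewrite leq_eqVlt => /predU1P[Kk|Kk].
  rewrite -Kk subnn qbinom0 (_ : [set _ in _ | _] = [set K]) ?cards1 //.
  apply/setP => S; rewrite !inE [RHS]eq_sym eqEdim.
  by case KS: (K <= S)%VS; rewrite ?andbF //= andbT eqn_leq (dimvS KS) andbT.
have k0 : 0 < qi (k - \dim K) by rewrite qint_gt0 // subn_gt0.
apply: (mulIf (lt0r_neq0 k0)).
have -> : (\dim {:V} - \dim K = (\dim {:V} - (\dim K).+1).+1)%N by lia.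
rewrite qbinomS ?subn_gt0 //.
rewrite (_ : (k - \dim K).-1 = k - (\dim K).+1)%N; last by lia.
transitivity (\sum_(S in subspaces V k | (K <= S)%VS) #|covers K S|%:R : R).
  rewrite (eq_bigr (fun=> qi (k - \dim K))) => [|S].
    rewrite sumr_const [LHS]mulr_natl; congr (_ *+ _).
    by apply: eq_card => S; rewrite [LHS]inE.
  by rewrite !inE => /andP[/eqP dS KS]; rewrite card_covers // dS.
transitivity (\sum_(U in covers K fullv)
    #|[set S in subspaces V k | (U <= S)%VS]|%:R : R).
  under eq_bigr do rewrite -sum1_card natr_sum.
  under [RHS]eq_bigr do rewrite -sum1_card natr_sum.
  rewrite (exchange_big_dep [in covers K fullv]) /=.
    apply: eq_bigr => U; rewrite !inE subvf andbT => /andP[/eqP dU KU].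
    apply: eq_bigl => S; rewrite !inE dU eqxx KU /=.
    case: (U <= S)%VS / boolP => US; rewrite ?andbF // !andbT.
    by rewrite (subv_trans KU US) andbT.
  by move=> S U _; rewrite !inE subvf andbT => /and3P[-> ->].
rewrite (eq_bigr (fun=> qbinom R q (\dim {:V} - (\dim K).+1) (k - (\dim K).+1))).
  rewrite sumr_const -mulr_natl card_covers ?subvf //; congr (qi _ * _).
  by lia.
by move=> U; rewrite !inE => /and3P[/eqP dU _ _]; rewrite IHe dU //; lia.
Qed.

End Covers.

(** * A light hyperplane avoiding a point *)

Section Hyperplane.
Variables (R : realType) (F : finFieldType) (V : vectType F).
Variable wt : {vspace V} -> R.
Local Notation D := (degree1_fun wt).
Local Notation q := #|F|.

(** The bound is the mean of [D] over the hyperplanes of [W] avoiding [P]. The induction takes a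
    suitable hyperplane [K] of some [W'] through [P] and averages only over hyperplanes of [W]
    through [K]. *)
Lemma hyperplane_avoiding d (P W : {vspace V}) :
    \dim P = 1%N -> (P <= W)%VS -> \dim W = d.+1 ->
  exists U, [/\ \dim U = d, (U <= W)%VS, ~~ (P <= U)%VS & D U * q%:R <= D W - D P].
Proof.
have q1 : (1 < q)%N := card_finField_gt1 F.
move=> P1; elim: d W => [|d IHd] W PW dW.
  have -> : W = P by apply/esym/eqP; rewrite eqEdim PW dW P1.
  exists 0%VS; rewrite dimv0 sub0v degree1_0 mul0r subrr lexx subv0 -dimv_eq0 P1.
  by [].
have [|W' [PW' W'W dW']] := @exists_between F V P W d.+1 PW.
  by rewrite P1 dW leqnSn.
have [K [dK KW' PK DK]] := IHd _ PW' dW'.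
have KW := subv_trans KW' W'W.
have W'c : W' \in covers K W by rewrite !inE dW' dK eqxx KW' W'W.
(* The q hyperplanes of W through K other than K + P = W' avoid P. *)
have cc : #|covers K W :\ W'|%:R = q%:R :> R.
  have : #|covers K W|%:R = 1 + q%:R :> R.
    rewrite card_covers // dW dK -addn2 addKn -[2%N]/(1 + 1)%N qintD // qint1 //.
    by rewrite expr1 mulr1.
  by rewrite (cardsD1 W') W'c natrD => /addrI.
have := sum_covers wt KW; rewrite (big_setD1 W') //=.
set s := \sum_(U in _) _ => ds.
have [||U] := @exists_le_mean R _ (covers K W :\ W') (fun U => D U * q%:R) (D W - D P).
- by rewrite -(ltr0n R) cc ltr0n ltnW.
- rewrite -mulr_suml cc ler_wpM2r ?ler0n //.
  move: ds; rewrite /s sumrB sumr_const -[D K *+ _]mulr_natr cc; lra.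
rewrite !inE => /and4P[UW' /eqP dU KU UW] DU.
exists U; split=> //; first by rewrite dU dK.
apply: contra UW' => PU; rewrite eq_sym eqEdim dW' dU dK leqnn andbT.
suff -> : W' = (K + P)%VS by rewrite subv_add KU PU.
apply/esym/eqP; rewrite eqEdim subv_add KW' PW' dW' dim_addv_point ?dK //=.
Qed.
End Hyperplane.

(** * The bound for families containing no pencil *)

Section Boolean.
Variables (R : realType) (F : finFieldType) (V : vectType F).
Variable wt : {vspace V} -> R.
Implicit Types (P S T U H : {vspace V}).
Local Notation D := (degree1_fun wt).
Local Notation q := #|F|.
Local Notation n := (\dim {:V}).
Local Notation qi := (qint R q).

Let q1 : (1 < q)%N := card_finField_gt1 F.

(** Exchanging sums: every point lies on the same number of [k]-subspaces. For a Boolean function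
    this identifies [x] with [D fullv]. *)
Lemma sum_degree1 k : (0 < k <= n)%N ->
  \sum_(S in subspaces V k) D S = D fullv * qbinom R q (n - 1) (k - 1).
Proof.
case/andP=> k0 kn; rewrite /degree1_fun.
rewrite (exchange_big_dep [in subspaces V 1]) /=; last by move=> S P _ /andP[].
rewrite mulr_suml [RHS](eq_bigl [in subspaces V 1]); last first.
  by move=> P /=; rewrite subvf andbT.
apply: eq_bigr => P P1; rewrite sumr_const -mulr_natr; congr (_ * _).
move: (P1); rewrite inE => /eqP dP.
rewrite -[in RHS]dP -card_subspaces_over ?dP //; congr _%:R.
apply: eq_card => S; rewrite [RHS]inE.
by rewrite [LHS](_ : _ = (S \in subspaces V k) &&
  ((P \in subspaces V 1) && (P <= S)%VS)) // P1.
Qed.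

Lemma sum_covers_full U : (\dim U < n)%N ->
  \sum_(S in covers U fullv) D S = D fullv + q%:R * qi (n - (\dim U).+1) * D U.
Proof.
move=> Un; have := sum_covers wt (subvf U).
rewrite sumrB sumr_const -[D U *+ _]mulr_natr card_covers ?subvf //.
have -> : (n - \dim U = 1 + (n - (\dim U).+1))%N by lia.
rewrite qintD // qint1 // expr1; lra.
Qed.

Lemma no_pencil_bound k :
    (0 < k < n)%N ->
    (forall S, \dim S = k -> D S = 0 \/ D S = 1) ->
    (exists2 S, \dim S = k & D S = 1) ->
    (forall P, \dim P = 1%N -> exists T, [/\ \dim T = k, (P <= T)%VS & D T = 0]) ->
  qi (n - k) <= D fullv * qi k.
Proof.
case: k => // k /= kn Dbool [S dS DS] zeroP.
(* The [[k.+1]] points of [S] have total weight 1, so some point has at least the mean weight. Signs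
   are reversed because [exists_le_mean] bounds from above. *)
have [P] : exists2 P, P \in [set P in subspaces V 1 | (P <= S)%VS] &
    - wt P <= - (qi k.+1)^-1.
  have cS : #|[set P in subspaces V 1 | (P <= S)%VS]|%:R = qi k.+1.
    rewrite -dS -degree1_const /degree1_fun sumr_const; congr _%:R.
    by apply: eq_card => P; rewrite [LHS]inE.
  apply: exists_le_mean; first by rewrite -(ltr0n R) cS qint_gt0.
  rewrite cS mulNr mulVf ?gt_eqF ?qint_gt0 // sumrN lerN2 -DS /degree1_fun.
  by rewrite le_eqVlt; apply/orP/or_introl/eqP/eq_bigl => P; rewrite [RHS]inE.
rewrite !inE lerN2 => /andP[/eqP P1 PS] wP.
have [T [dT PT DT]] := zeroP _ P1.
have [U [dU UT PU DU]] := hyperplane_avoiding wt P1 PT dT.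
have := sum_covers_full (U := U); rewrite dU => /(_ (ltnW kn)) sumU.
have : 0 <= \sum_(S in covers U fullv) D S.
  apply: sumr_ge0 => W; rewrite !inE dU => /andP[/eqP dW _].
  by case: (Dbool _ dW) => ->; rewrite ?ler01.
rewrite sumU => sum0.
move: DU; rewrite DT (degree1_point wt P1) sub0r => DU.
have k0 : 0 < qi k.+1 by rewrite qint_gt0.
rewrite -ler_pdivrMr //.
(* Combine [0 <= D fullv + q [n - k.+1] D U], [q D U <= - wt P] and [wt P >= 1 / [k.+1]]. *)
have m0 : 0 <= qi (n - k.+1) by apply: qint_ge0.
have := ler_wpM2l m0 wP; have := ler_wpM2l m0 DU; lra.
Qed.

End Boolean.

(** * The bound for families properly containing a pencil *)

Section ContainsPencil.
Variables (R : realType) (F : finFieldType) (V : vectType F).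
Variable wt : {vspace V} -> R.
Implicit Types (P S T U H : {vspace V}).
Local Notation D := (degree1_fun wt).
Local Notation q := #|F|.
Local Notation n := (\dim {:V}).
Local Notation qi := (qint R q).

Lemma contains_pencil_bound k P0 :
    (1 < k < n)%N ->
    (forall S, \dim S = k -> D S = 0 \/ D S = 1) ->
    \dim P0 = 1%N ->
    (forall S, \dim S = k -> (P0 <= S)%VS -> D S = 1) ->
    (exists S, [/\ \dim S = k, ~~ (P0 <= S)%VS & D S = 1]) ->
  qi (n - k) + qi k <= D fullv * qi k.
Proof.
case/andP=> k1 kn Dbool P01 DP0 [S [dS PS DS]].
(* The weight function of Y with the pencil of P0 removed. *)
pose wt' P := wt P - (P == P0)%:R.
have D'E W : degree1_fun wt' W = D W - (P0 <= W)%VS%:R.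
  rewrite /degree1_fun /wt' sumrB; congr (_ - _).
  case P0W: (P0 <= W)%VS; last first.
    rewrite big1 // => P /andP[_ PW]; case: eqP => // PP.
    by rewrite -PP PW in P0W.
  rewrite (bigD1 P0) ?inE ?P01 //= eqxx big1 ?addr0 // => P /andP[_].
  by move/negbTE->.
suff : qi (n - k) <= degree1_fun wt' fullv * qi k by rewrite D'E subvf mulrBl mul1r; lra.
apply: no_pencil_bound => [|T dT||P P1].
- by rewrite ltnW.
- rewrite D'E; case: (boolP (P0 <= T)%VS) => [PT|_]; last first.
    by rewrite subr0; apply: Dbool.
  by left; rewrite (DP0 T) // subrr.
- by exists S => //; rewrite D'E (negbTE PS) DS subr0.
(* Since [k >= 2], some [k]-subspace contains both [P0] and [P]; it was removed with the pencil, so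
   its new value is 0. *)
have [|T [T1 _ dT]] := @exists_between F V (P0 + P) fullv k (subvf _).
  rewrite (ltnW kn) andbT (leq_trans _ k1) //.
  by rewrite (leq_trans (dimv_add_leqif _ _)) // P01 P1.
move: T1; rewrite subv_add => /andP[P0T PT].
by exists T; split=> //; rewrite D'E P0T DP0 // subrr.
Qed.

End ContainsPencil.

(** * The exceptional case of lines *)

Section Lines.
Variables (R : realType) (F : finFieldType) (V : vectType F).
Variable wt : {vspace V} -> R.
Implicit Types (P S T U H : {vspace V}).
Local Notation D := (degree1_fun wt).
Local Notation q := #|F|.
Local Notation n := (\dim {:V}).
Local Notation qi := (qint R q).

(** Let [c P] be the number of lines of [Y] through [P] and [m = [n-2]]. The assumed upper bound on
    [D fullv] forces the sum of [c] over a line to be [m] outside [Y] and [m (1 + q)] in [Y]. Hence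
    [c] takes only the values 0 and [m], and its support is a hyperplane. *)
Lemma lines_hyperplane :
    (2 < n)%N ->
    (forall S, \dim S = 2%N -> D S = 0 \/ D S = 1) ->
    (exists2 S, \dim S = 2%N & D S = 1) ->
    (forall P, \dim P = 1%N -> exists T, [/\ \dim T = 2%N, (P <= T)%VS & D T = 0]) ->
    D fullv * (q%:R * qi 2) < qi (n - 1) ->
  exists2 H, \dim H = n.-1 & forall S, \dim S = 2%N -> (D S == 1) = (S <= H)%VS.
Proof.
move=> n2 Dbool Yex zeroP xlt.
have q1 : (1 < q)%N := card_finField_gt1 F.
have xge : qi (n - 2) <= D fullv * qi 2.
  by apply: no_pencil_bound zeroP => //; rewrite n2.
have [m mE] := qint_nat R q1 (n - 2).
have m0 : (0 < m)%N by rewrite -(ltr0n R) -mE qint_gt0 // subn_gt0.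
pose c P := #|[set S in covers P fullv | D S == 1]|.
have cE P : \dim P = 1%N -> (c P)%:R = D fullv + q%:R * m%:R * wt P.
  move=> P1; have := sum_covers_full wt (U := P); rewrite P1 mE (degree1_point wt P1).
  move=> <-; last by lia.
  rewrite (big_setID [set S | D S == 1]) /= [X in _ + X]big1 ?addr0.
    rewrite /c -sum1_card natr_sum; apply: eq_big => S; first by rewrite !inE.
    by rewrite !inE => /andP[_ /eqP->].
  move=> S; rewrite !inE P1 => /and3P[DS /eqP dS _].
  by case: (Dbool _ dS) DS => // ->; rewrite eqxx.
have csum T : \dim T = 2%N ->
  (\sum_(P in subspaces V 1 | (P <= T)%VS) c P)%:R
    = D fullv * qi 2 + q%:R * m%:R * D T :> R.
  move=> dT; rewrite natr_sum.
  rewrite (eq_bigr (fun P => D fullv * 1 + q%:R * m%:R * wt P)); last first.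
    by move=> P /andP[]; rewrite inE => /eqP P1 _; rewrite mulr1 cE.
  by rewrite big_split /= -!mulr_sumr -dT -degree1_const.
(* D fullv * qi 2 is the sum of c over a line outside Y, hence an integer, and
   it lies in the interval [m, m + 1/q[. *)
have xE : D fullv * qi 2 = m%:R.
  have [P P1 _] : exists2 P, \dim P = 1%N & (P <= {:V})%VS.
    by apply: exists_point; lia.
  have [T [dT _ DT]] := zeroP P P1.
  have := csum _ dT; rewrite DT mulr0 addr0 => NE.
  apply/eqP; rewrite eq_le -{2}mE xge andbT -NE ler_nat -ltnS -(ltr_nat R) NE.
  move: xlt; rewrite (_ : n - 1 = 1 + (n - 2))%N; last by lia.
  rewrite qintD // qint1 // expr1 mE -natr1 mulrCA => xlt.
  have q2 : 1 < q%:R :> R by rewrite ltr1n.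
  rewrite -(ltr_pM2l (lt_trans ltr01 q2)); lra.
have csum0 T : \dim T = 2%N -> D T = 0 ->
  (\sum_(P in subspaces V 1 | (P <= T)%VS) c P)%N = m.
  move=> dT DT; apply/eqP; rewrite -(eqr_nat R) csum // DT xE mulr0 addr0.
  by [].
(* Every point lies on a line outside [Y], where the values of [c] add up to [m]. *)
have c_le P : \dim P = 1%N -> (c P <= m)%N.
  move=> P1; have [T [dT PT DT]] := zeroP P P1.
  by rewrite -(csum0 T dT DT) (bigD1 P) ?leq_addr // inE P1.
have card2 T : \dim T = 2%N ->
  \sum_(P in subspaces V 1 | (P <= T)%VS) (1 : R) = 1 + q%:R.
  move=> dT; rewrite -[LHS]/(degree1_fun (fun=> 1) T) degree1_const dT.
  by rewrite -[2%N]/(1 + 1)%N qintD // qint1 // expr1 mulr1.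
(* On a line of [Y] the nonnegative numbers [m - c P] add up to 0. *)
have c1 T P : \dim T = 2%N -> D T = 1 -> \dim P = 1%N -> (P <= T)%VS -> c P = m.
  move=> dT DT P1 PT.
  have cm : \sum_(P in subspaces V 1 | (P <= T)%VS) (m%:R - (c P)%:R : R) = 0.
    rewrite sumrB -[X in _ - X]natr_sum csum // xE DT mulr1.
    have := card2 _ dT; move/(congr1 ( *%R m%:R)); rewrite mulr_sumr.
    under eq_bigr do rewrite mulr1.
    move=> ->; ring.
  have := psumr_eq0P _ cm => /(_ _ P); rewrite inE P1 PT => H.
  apply/eqP; rewrite eq_sym -(eqr_nat R) -subr_eq0; apply/eqP/H => //.
  by move=> Q /andP[]; rewrite inE => /eqP Q1 _; rewrite subr_ge0 ler_nat c_le.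
have cm P : \dim P = 1%N -> c P != 0%N -> c P = m.
  move=> P1; rewrite -lt0n card_gt0 => /set0Pn[S].
  rewrite !inE P1 subvf andbT => /andP[/andP[/eqP dS PS] /eqP DS].
  exact: (c1 S).
(* If [c] vanishes nowhere on [T], its sum there is [m (1 + q)], which differs from the value [m]
   for lines outside [Y]. *)
have call T : \dim T = 2%N ->
   (forall P, \dim P = 1%N -> (P <= T)%VS -> c P != 0%N) -> D T = 1.
  move=> dT cT; case: (Dbool _ dT) => // DT.
  have : (\sum_(P in subspaces V 1 | (P <= T)%VS) c P)%:R = (m%:R * (1 + q%:R) : R).
    rewrite -(card2 T) // mulr_sumr natr_sum; apply: eq_bigr => P /andP[].
    by rewrite inE => /eqP P1 PT; rewrite mulr1 cm // cT.
  rewrite csum0 // mulrDr mulr1 => /eqP.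
  rewrite -subr_eq0 opprD addrA subrr add0r oppr_eq0 mulf_eq0 !pnatr_eq0.
  by case/orP => /eqP E; rewrite E in m0 q1.
have [|||H dH AH] := @hyperplane_of_points F V (fun P => c P != 0%N).
(* Two points with [c = m] already give [2 m > m], so [L] belongs to [Y]. *)
- move=> L P Q Z dL P1 Q1 Z1 PL QL ZL PQ cP cQ.
  rewrite (c1 L) -?lt0n //; case: (Dbool _ dL) => // DL; exfalso.
  have := csum0 L dL DL; rewrite (bigD1 P) ?inE ?P1 //= (bigD1 Q) /=; last first.
    by rewrite inE Q1 QL eq_sym PQ.
  by rewrite (cm P) // (cm Q) //; lia.
(* The sum of [c] over any line is positive. *)
- move=> L dL; have [P PL cP] : exists2 P,
      P \in [set P in subspaces V 1 | (P <= L)%VS] & c P != 0%N.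
    apply/exists_inP; apply: contraT => /exists_inPn H.
    have /eqP := csum _ dL; rewrite big1.
      rewrite xE eq_sym; case: (Dbool _ dL) => ->.
        by rewrite mulr0 addr0 pnatr_eq0 => /eqP E; rewrite E in m0.
      by rewrite mulr1 -natrM -natrD pnatr_eq0 addn_eq0 => /andP[/eqP E]; rewrite E in m0.
    move=> P /andP[P1 PL]; apply/eqP; have := H P; rewrite !inE negbK; apply.
    by rewrite inE in P1; rewrite P1.
  by move: PL; rewrite !inE => /andP[/eqP P1 PL]; exists P.
(* By [call], a line outside [Y] has a point with [c = 0]. *)
- have [P P1 _] : exists2 P, \dim P = 1%N & (P <= {:V})%VS.
    by apply: exists_point; lia.
  have [T [dT _ DT]] := zeroP P P1.
  have [Z Zin cZ] : exists2 P,
      P \in [set P in subspaces V 1 | (P <= T)%VS] & ~~ (c P != 0%N).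
    apply/exists_inP; apply: contraT => /exists_inPn H.
    have : D T = 1.
      apply: call => // Q Q1 QT; have := H Q; rewrite negbK; apply.
      by rewrite !inE Q1.
    by rewrite DT => /eqP; rewrite eq_sym oner_eq0.
  by exists Z => //; move: Zin; rewrite !inE => /andP[/eqP].
exists H => // S dS; apply/eqP/idP => [DS|SH].
  apply: subv_points => P P1 PS; rewrite -AH // (c1 S) // -lt0n //.
apply: call => // P P1 PS; rewrite AH //; exact: subv_trans PS SH.
Qed.

End Lines.

(** * Comparing the bounds with the claim *)

Section Arithmetic.
Variables (R : realType) (q : nat).
Hypothesis q_gt1 : (1 < q)%N.
Local Notation qi := (qint R q).

Let Q1 : 1 < q%:R :> R. Proof. by rewrite ltr1n. Qed.

Lemma le_qint a b : (a <= b)%N -> qi a <= qi b.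
Proof.
move=> ab; rewrite -(subnKC ab) qintD // lerDl mulr_ge0 ?qint_ge0 //.
by rewrite exprn_ge0 ?ler0n.
Qed.

Lemma qint_ge1 a : (0 < a)%N -> 1 <= qi a.
Proof. by move=> a0; rewrite -(qint1 R q_gt1) le_qint. Qed.

(** The power [q ^ (k - 1)] is rewritten through [[k - 1]], so that the inequalities below become
    polynomial in [Q = q], [B = [k - 1]] and [M = [n - k]]. *)
Lemma qint_split n k : (0 < k <= n)%N ->
  qi (n - 1) = qi (k - 1) + (1 + (q%:R - 1) * qi (k - 1)) * qi (n - k).
Proof.
case/andP=> k0 kn; rewrite (_ : n - 1 = (k - 1) + (n - k))%N; last by lia.
rewrite qintD // -[q%:R ^+ _](subrK 1) -qintM1 //; ring.
Qed.

Lemma qint_pred k : (0 < k)%N -> qi k = 1 + q%:R * qi (k - 1).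
Proof.
by move=> k0; rewrite -{1}(subnKC k0) qintD // qint1 // expr1.
Qed.

Lemma pencil_bound_suffices n k (x : R) : (1 < k < n)%N ->
  qi (n - k) + qi k <= x * qi k ->
  qi (n - 1) / (q%:R * qi (k - 1) ^+ 2 * qi k) <= x.
Proof.
case/andP=> k1 kn H; have k0 := ltnW k1.
have C0 : 0 < qi k by apply: qint_gt0.
have B1 : 1 <= qi (k - 1) by rewrite qint_ge1 // subn_gt0.
have M0 : 0 <= qi (n - k) by rewrite qint_ge0.
have B0 := lt_le_trans ltr01 B1; have Q0 := lt_trans ltr01 Q1.
have QB0 : 0 < q%:R * qi (k - 1) ^+ 2 by rewrite mulr_gt0 ?exprn_gt0.
rewrite ler_pdivrMr; last exact: mulr_gt0.
rewrite mulrCA.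
apply: le_trans (ler_wpM2l (ltW QB0) H).
rewrite (@qint_split n k) ?k0 1?ltnW // (qint_pred k0).
move: {H C0 QB0} B1 M0 B0 Q0 (Q1).
move: (q%:R) (qi (k - 1)) (qi (n - k)) => Q B M B1 M0 B0 Q0 Q_1.
have t0 : 0 <= Q * B * (B - 1) by rewrite !mulr_ge0 ?subr_ge0 // ltW.
have QB : B <= Q * B by rewrite ler_peMl // ltW.
have s0 : 0 <= M * (Q * B * (B - 1) + (B - 1)).
  by rewrite mulr_ge0 // addr_ge0 // subr_ge0.
have r0 : 0 <= Q * B ^+ 2 * (Q * B) by rewrite !mulr_ge0 ?exprn_ge0 // ltW.
rewrite -subr_ge0.
(* With [[k] = 1 + Q B], the difference is a sum of terms that are nonnegative because [B >= 1] and
   [Q > 1]. *)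
rewrite [leRHS](_ : _ = M * (Q * B * (B - 1) + (B - 1)) + Q * B ^+ 2 * (Q * B)
  + (Q * B * (B - 1) + (Q * B - B))); last by ring.
apply: addr_ge0; first exact: addr_ge0.
by apply: addr_ge0 => //; rewrite subr_ge0.
Qed.

(** The condition [k > 2] gives [B >= 1 + Q]. For [k = 2] one has [B = 1], and the bound [q [n-2] <=
    q [2] x] falls short of the target [[n-1] = 1 + q [n-2]] by 1. *)
Lemma no_pencil_bound_suffices n k (x : R) : (2 < k < n)%N ->
  qi (n - k) <= x * qi k ->
  qi (n - 1) / (q%:R * qi (k - 1) ^+ 2 * qi k) <= x.
Proof.
case/andP=> k2 kn H; have k0 : (0 < k)%N by lia.
have C0 : 0 < qi k by apply: qint_gt0.
have B1 : 1 + q%:R <= qi (k - 1).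
  have <- : qi 2 = 1 + q%:R by rewrite qint_pred // qint1 // mulr1.
  by rewrite le_qint //; lia.
have M1 : 1 <= qi (n - k) by rewrite qint_ge1 // subn_gt0.
have Q0 := lt_trans ltr01 Q1.
have B0 : 0 < qi (k - 1) by apply: lt_le_trans B1; rewrite addr_gt0.
have QB0 : 0 < q%:R * qi (k - 1) ^+ 2 by rewrite mulr_gt0 ?exprn_gt0.
rewrite ler_pdivrMr; last exact: mulr_gt0.
rewrite mulrCA.
apply: le_trans (ler_wpM2l (ltW QB0) H).
rewrite (@qint_split n k) ?k0 1?ltnW //.
move: {H C0 QB0} B1 M1 B0 Q0 (Q1).
move: (q%:R) (qi (k - 1)) (qi (n - k)) => Q B M B1 M1 B0 Q0 Q_1.
have s0 : 0 <= B * (M - 1) by rewrite mulr_ge0 ?subr_ge0 // ltW.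
have B2 : 1 <= B by lra.
have t0 : 0 <= (Q * B * (B - 1 - Q) + Q * Q * B - 1) * M.
  apply: mulr_ge0; last by lra.
  have : 0 <= Q * B * (B - 1 - Q).
    rewrite mulr_ge0 ?(mulr_ge0 (ltW Q0) (ltW B0)) //.
    by lra.
  have : 1 <= Q * Q * B by rewrite -[1]mulr1 ler_pM // -[1]mulr1 ler_pM // ltW.
  lra.
rewrite -subr_ge0.
rewrite [leRHS](_ : _ = (Q * B * (B - 1 - Q) + Q * Q * B - 1) * M
  + B * (M - 1)); last by ring.
exact: addr_ge0.
Qed.

(** Use [[n-1] >= q ^ (n-2)] and [(q-1) [a] < q ^ a] for the three factors below. This leaves
    [((q-1)/q) ^ 3], which is at least [1/8] since [q >= 2]. *)
Lemma qint_ratio_gt n k : (1 < k < n)%N ->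
  1 / 8 * q%:R ^ (n%:Z - 3 * k%:Z + 2) <
  qi (n - 1) / (q%:R * qi (k - 1) ^+ 2 * qi k).
Proof.
case/andP=> k1 kn; have k0 := ltnW k1.
have Q0 : 0 < q%:R :> R := lt_trans ltr01 Q1.
set w := _ ^ _; have w0 : 0 < w by rewrite exprz_gt0.
have B0 : 0 < qi (k - 1) by rewrite qint_gt0 // subn_gt0.
have C0 : 0 < qi k by rewrite qint_gt0.
have QB0 : 0 < q%:R * qi (k - 1) ^+ 2 by rewrite mulr_gt0 ?exprn_gt0.
rewrite ltr_pdivlMr; last exact: mulr_gt0.
have N0 : 0 < q%:R ^+ (n - 2) :> R by rewrite exprn_gt0.
have nN : q%:R ^+ (n - 2) <= qi (n - 1).
  rewrite (_ : n - 1 = (n - 2) + 1)%N; last by lia.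
  by rewrite qintD // qint1 // mulr1 lerDr qint_ge0.
apply: lt_le_trans nN.
(* The exponent in [w] may be negative; multiplying by [q ^ (3k-3)] returns to natural exponents. *)
have wE : w * (q%:R ^+ (k - 1)) ^+ 3 = q%:R ^+ (n - 2) * q%:R.
  rewrite -exprM -exprSr /w !exprnP -expfzDr ?gt_eqF //; congr (_ ^ _).
  by lia.
have BE := qintM1 R q_gt1 (k - 1).
have CE : qi k * (q%:R - 1) = q%:R * q%:R ^+ (k - 1) - 1.
  by rewrite qintM1 // -exprS; congr (_ ^+ _ - _); lia.
move: wE BE CE N0 B0 C0.
have u0 : 0 < q%:R ^+ (k - 1) :> R by rewrite exprn_gt0.
move: (q%:R ^+ (k - 1)) u0 => u u0.
move: (q%:R ^+ (n - 2)) (qi (k - 1)) (qi k) w w0 Q0 (Q1) => N B C w w0.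
have Q2 : 2 <= q%:R :> R by rewrite ler_nat.
move: (q%:R) Q2 => Q Q2 Q0 Q_1 wE BE CE N0 B0 C0.
have P0 : 0 < (Q - 1) ^+ 3 by rewrite exprn_gt0 // subr_gt0.
rewrite -(ltr_pM2r P0).
have -> : 1 / 8 * w * (Q * B ^+ 2 * C) * (Q - 1) ^+ 3 =
  (w * Q / 8) * ((B * (Q - 1)) ^+ 2 * (C * (Q - 1))) by field.
apply: (@lt_le_trans _ _ ((w * Q / 8) * (u ^+ 2 * (Q * u)))).
  rewrite ltr_pM2l; last by rewrite divr_gt0 ?mulr_gt0.
  have BQ : 0 < B * (Q - 1) by rewrite mulr_gt0 ?subr_gt0.
  have CQ : 0 < C * (Q - 1) by rewrite mulr_gt0 ?subr_gt0.
  apply: ltr_pM; rewrite ?exprn_ge0 1?ltW //; last by rewrite CE gtrBl.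
  rewrite ltr_pXn2r ?nnegrE ?ltW //; by rewrite BE gtrBl.
have -> : w * Q / 8 * (u ^+ 2 * (Q * u)) = (w * u ^+ 3) * Q ^+ 2 / 8 by ring.
rewrite wE; have -> : N * Q * Q ^+ 2 / 8 = N * (Q / 2) ^+ 3 by field.
rewrite ler_pM2l // ler_pXn2r ?nnegrE //; lra.
Qed.

End Arithmetic.

(** * Case analysis for the theorem *)

Theorem theorem15 (R : realType) (F : finFieldType) (V : vectType F)
    (q n k : nat) (Y : {set {vspace V}}) (x : R)
    (hq : #|F| = q) (hn : \dim {:V} = n) (hk : (2 <= k)%N)
    (hY : boolean_degree1 R k Y)
    (hx : #|Y|%:R = x * qbinom R q (n - 1) (k - 1))
    (hY0 : Y <> set0)
    (hYP : forall P : {vspace V}, \dim P = 1%N -> Y <> pencil k P)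
    (hYH : k = 2%N ->
       forall H : {vspace V}, \dim H = (n - 1)%N -> Y <> subspaces_in k H) :
  x >= qint R q (n - 1) / (q%:R * qint R q (k - 1) ^+ 2 * qint R q k) /\
  qint R q (n - 1) / (q%:R * qint R q (k - 1) ^+ 2 * qint R q k)
    > 1 / 8 * q%:R ^ (n%:Z - 3 * k%:Z + 2).
Proof.
have q1 : (1 < q)%N by rewrite -hq; exact: card_finField_gt1.
case: hY => wt [Dbool' YE].
have Dbool S : \dim S = k -> degree1_fun wt S = 0 \/ degree1_fun wt S = 1.
  by move=> dS; apply: Dbool'; rewrite inE dS.
have inY S : (S \in Y) = (\dim S == k) && (degree1_fun wt S == 1).
  by rewrite YE !inE.
have [S0 S0Y] : exists S, S \in Y by apply/set0Pn/eqP.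
have /andP[/eqP dS0 /eqP DS0] : (\dim S0 == k) && (degree1_fun wt S0 == 1).
  by rewrite -inY.
(* If [k = n], then [Y] consists of the whole space only, which is the pencil of any point. *)
have kn : (k < n)%N.
  rewrite ltn_neqAle -hn -{2}dS0 dimvS ?subvf // andbT; apply/negP => /eqP kn.
  have full (S : {vspace V}) : \dim S = k -> S = fullv.
    by move=> dS; apply/eqP; rewrite eqEdim subvf dS kn leqnn.
  have [|P P1 _] := @exists_point F V fullv; first by rewrite -kn; lia.
  apply: (hYP P P1); apply/setP => S; rewrite inY !inE.
  case: eqP => //= dS; rewrite (full S) // subvf -(full S0) //.
  by apply/eqP.
have xE : degree1_fun wt fullv = x.
  have b0 : qbinom R q (n - 1) (k - 1) != 0.
    by rewrite gt_eqF // qbinom_gt0 //; lia.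
  apply: (mulIf b0); rewrite -hx -hq -hn -sum_degree1; last by rewrite hn; lia.
  rewrite (bigID [in Y]) /= [X in _ + X]big1 ?addr0; last first.
    move=> S /andP[]; rewrite inE inY => /eqP dS; rewrite dS eqxx /=.
    by case: (Dbool S dS) => // ->; rewrite eqxx.
  rewrite -sum1_card natr_sum; apply/esym/eq_big => S; last first.
    by rewrite inY => /andP[_ /eqP ->].
  by rewrite inY inE; case: eqP.
have ratio : (1 < k < n)%N by rewrite hk.
split; last exact: qint_ratio_gt.
(* Split on whether [Y] contains the full pencil of some point. *)
have [/exists_inP[P0]|/exists_inPn noP] :=
    boolP [exists P in subspaces V 1, pencil k P \subset Y].
  rewrite inE => /eqP P01 /subsetP PY; apply: pencil_bound_suffices => //.
  rewrite -xE -hq -hn; apply: (@contains_pencil_bound _ _ _ wt k P0) => //.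
  - by rewrite hn.
  - move=> S dS PS; have := PY S; rewrite inY !inE dS eqxx PS => /(_ isT).
    by move/eqP.
  have [S SY PS] : exists2 S, S \in Y & ~~ (P0 <= S)%VS.
    apply/exists_inP; apply: contraT => /exists_inPn H.
    case: (hYP P0 P01); apply/eqP; rewrite eqEsubset; apply/andP; split.
      apply/subsetP => S SY; have := H S SY; rewrite negbK => PS.
      by move: SY; rewrite inY !inE PS => /andP[->].
    exact/subsetP.
  by exists S; move: SY; rewrite inY => /andP[/eqP ? /eqP ?].
have zeroP P : \dim P = 1%N ->
    exists T, [/\ \dim T = k, (P <= T)%VS & degree1_fun wt T = 0].
  move=> P1; have /subsetPn[T] : ~~ (pencil k P \subset Y).
    by apply: noP; rewrite inE P1.
  rewrite inY !inE => /andP[/eqP dT PT]; rewrite dT eqxx /= => DT.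
  by exists T; split=> //; case: (Dbool T dT) DT => // ->; rewrite eqxx.
have S0ex : exists2 S, \dim S = k & degree1_fun wt S = 1 by exists S0.
case: (ltnP 2 k) => k2.
  apply: (no_pencil_bound_suffices q1); first by rewrite k2.
  by rewrite -xE -hq -hn; apply: no_pencil_bound => //; rewrite hn; lia.
have k2E : k = 2%N by apply/eqP; rewrite eqn_leq k2.
(* For [k = 2] a violation would make [Y] the set of lines in a hyperplane, contradicting [hYH]. *)
rewrite leNgt; apply/negP => xlt; move: Dbool zeroP S0ex; rewrite k2E.
move=> Dbool zeroP S0ex.
have [||H dH YH] := @lines_hyperplane _ _ _ wt _ Dbool S0ex zeroP.
- by rewrite hn; lia.
- rewrite xE hq hn; move: xlt; rewrite k2E ltr_pdivlMr; last first.
    apply: mulr_gt0; last exact: qint_gt0.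
    by apply: mulr_gt0; [rewrite ltr0n ltnW | apply/exprn_gt0/qint_gt0].
  by rewrite subSS subn0 qint1 // expr1n mulr1.
case: (hYH k2E H); first by rewrite dH hn subn1.
apply/setP => S; rewrite inY !inE k2E.
by case: eqP => //= dS; rewrite YH.
Qed.
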